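(* Let $\mathcal{A}=(a_i)_{i=1}^\infty$ be a weakly increasing sequence of positive integers and let $m\geq 2$ be an integer. Let $k\geq 4$ be an integer, and suppose that $\gcd A=1$ for every $(k-2)$-multisubset $A$ of the multiset $\{a_1,a_2,\ldots,a_k\}$. Put $D=\operatorname{lcm}(a_1,\ldots,a_k)$ and $\hat d=\frac{1}{k}\prod_{i=1}^k(1+iDk)$. If $2\hat d\geq 3m^3$, then $$p_\mathcal{A}(n,k)^2>p_\mathcal{A}(n+m,k)\,p_\mathcal{A}(n-m,k)$$ holds for all integers $n\geq \hat d$; otherwise this inequality holds for all integers $n\geq 3m$. Moreover, for the constant sequence $\mathcal{A}=(1,1,1,\ldots)$, the inequality holds for all positive integers $n$ and all $k\geq 2$.
   Context: For a weakly increasing sequence $\mathcal{A}=(a_i)_{i\ge1}$ of positive integers and a positive integer $k$, the restricted partition function $p_\mathcal{A}(n,k)$ is defined by $\sum_{n\ge0}p_\mathcal{A}(n,k)x^n=\prod_{i=1}^k(1-x^{a_i})^{-1}$; equivalently, it counts the partitions of $n$ whose parts lie in the multiset $\{a_1,\ldots,a_k\}$ (equal values $a_i=a_j$ with $i\ne j$ are treated as distinct ''colors'' of a part; order of parts is irrelevant). Thus $p_\mathcal{A}(0,k)=1$, and $p_\mathcal{A}(n,k)=0$ for $n<0$. A $j$-multisubset of $\{a_1,\ldots,a_k\}$ is a sub-multiset obtained by choosing $j$ of the $k$ indices. *)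

(* Defs.v *)
From mathcomp Require Import all_boot all_order all_algebra.
Set Implicit Arguments. Unset Strict Implicit. Unset Printing Implicit Defensive.
Import Order.TTheory GRing.Theory Num.Theory.

(* The sequence A = (a_i)_{i>=1} is modelled by a : nat -> nat, read 1-based
   (a 0 is irrelevant). *)

(* p_A(n,k) for n : int: the number of tuples (c_1,...,c_k) of nonnegative
   integers with sum_i c_i a_i = n (partitions of n with parts in the multiset
   {a_1,...,a_k}, equal values being distinct colours); 0 for n < 0.
   When all a_i >= 1, each c_i <= n, so bounding c_i by n loses nothing. *)
Definition pA (a : nat -> nat) (n : int) (k : nat) : nat :=
  match n with
  | Posz N => #|[set c : {ffun 'I_k -> 'I_N.+1} |
                 (\sum_(i < k) (c i : nat) * a i.+1)%N == N]|
  | Negz _ => 0%N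
  end.

Definition lcmA (a : nat -> nat) (k : nat) : nat :=
  \big[lcmn/1%N]_(1 <= i < k.+1) a i.

Definition dhat (a : nat -> nat) (k : nat) : rat :=
  (\prod_(1 <= i < k.+1) (1 + i * lcmA a k * k)%N)%:R / k%:R.

(* gcd A = 1 for every (k-2)-multisubset A of {a_1,...,a_k}
   (sub-multisets given by choosing k-2 of the k indices). *)
Definition gcd_cond (a : nat -> nat) (k : nat) : Prop :=
  forall S : {set 'I_k}, #|S| = (k - 2)%N ->
    \big[gcdn/0%N]_(i in S) a i.+1 = 1%N.

(* Main.v *)
(* With D = lcm(a_1,...,a_k) and Q(x) = prod_i (1-x^D)/(1-x^{a_i}) = sum_j b_j x^j,
   the generating function is Q/(1-x^D)^k, so that (k-1)! D^(k-1) p(n) is the sum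
   of b_j h(n-j) over j = n mod D, where h(y) = prod_{0<i<k} (y+iD).  The gcd
   condition makes every D-th root of unity other than 1 a triple root of Q, hence
   the moments of order 0, 1, 2 of (b_j) on a residue class mod D do not depend on
   the class.  Replacing the classes of n+m and n-m by that of n therefore costs
   only a cubic Taylor remainder, of relative size O((kD)^3/n^3).  Once all three
   sums run over the same class, a comparison of h(u+m)h(v-m) + h(u-m)h(v+m) with
   2h(u)h(v), for u = n-j and v = n-j', gains a relative (3/4)(m/n)^2.  In both
   cases of the theorem 3m <= n and 2 dhat <= n m^2, and this makes the gain larger
   than the remainders. *)
Require Import Defs.
From mathcomp Require Import all_boot all_order all_algebra all_field.
From mathcomp Require Import zify ring lra.
Import Order.TTheory GRing.Theory Num.Theory.
Local Open Scope ring_scope.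
Set Implicit Arguments. Unset Strict Implicit. Unset Printing Implicit Defensive.

(** * Generating functions *)

(** A polynomial stand-in for two objects: the series 1/(1-x^a) truncated below degree wa and, for w
    = D/a, the exact quotient (1-x^D)/(1-x^a). *)
Definition box_gf (R : nzSemiRingType) (a w : nat) : {poly R} :=
  \sum_(c < w) 'X^(c * a).

Lemma coef_box_gf (R : nzSemiRingType) (a w s : nat) : (0 < a)%N ->
  (box_gf R a w)`_s = ((a %| s) && (s < w * a))%N%:R.
Proof.
move=> a0; rewrite /box_gf coef_sum.
under eq_bigr do rewrite coefXn.
have [/dvdnP[q ->]|ndiv] /= := boolP (a %| s)%N; last first.
  rewrite big1 // => c _; case: eqP => // E; by rewrite E dvdn_mull in ndiv.
rewrite ltn_pmul2r //.
have [qw|wq] := ltnP q w.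
  rewrite (bigD1 (Ordinal qw)) //= eqxx big1 ?addr0 // => c.
  by rewrite eqn_pmul2r // -val_eqE /= eq_sym => /negPf ->.
rewrite big1 // => c _; rewrite eqn_pmul2r //.
by case: eqP => // E; have := ltn_ord c; rewrite -E ltnNge wq.
Qed.

(** Euclidean division: every exponent below Lw is uniquely qw + c with c < w and q < L. *)
Lemma box_gf_mul (R : nzSemiRingType) (a w L : nat) :
  box_gf R a w * box_gf R (w * a) L = box_gf R a (L * w).
Proof.
rewrite /box_gf -[RHS](big_mkord predT (fun e => 'X^(e * a) : {poly R})).
rewrite big_nat_mul big_mkord mulr_sumr; apply: eq_bigr => q _.
rewrite mulSnr -{1}[(q * w)%N]add0n big_addn addKn big_mkord mulr_suml.
by apply: eq_bigr => c _; rewrite -exprD mulnDl mulnA.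
Qed.

Lemma coef_prod_ext (R : nzSemiRingType) (k n : nat) (F G : 'I_k -> {poly R}) :
  (forall i s, (s <= n)%N -> (F i)`_s = (G i)`_s) ->
  forall s, (s <= n)%N -> (\prod_(i < k) F i)`_s = (\prod_(i < k) G i)`_s.
Proof.
move=> FG; elim/big_ind2: _ => // [p1 p2 q1 q2 H1 H2 s sn|i _ s sn]; last exact: FG.
rewrite !coefM; apply: eq_bigr => j _.
by rewrite H1 ?H2 //; have := ltn_ord j; lia.
Qed.

Lemma pA_coef (a : nat -> nat) (n k : nat) :
  pA a n k = (\prod_(i < k) box_gf nat (a i.+1) n.+1)`_n.
Proof.
rewrite /pA /box_gf bigA_distr_bigA /= coef_sum -sum1dep_card big_mkcond /=.
apply: eq_bigr => f _.
by rewrite prodrXr coefXn eq_sym; case: eqP.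
Qed.

(** In degrees below [L] the truncation is invisible, so these are the coefficients of
    1/(1-x)^(k+1). The induction on [k] is the hockey-stick identity. *)
Lemma coef_geom_exp (R : nzSemiRingType) (k L q : nat) : (q < L)%N ->
  (box_gf R 1 L ^+ k.+1)`_q = 'C(q + k, k)%:R.
Proof.
elim: k q => [|k IH] q qL.
  by rewrite expr1 coef_box_gf // dvd1n muln1 qL bin0.
rewrite exprSr coefM.
have E (j : 'I_q.+1) : (box_gf R 1 L ^+ k.+1)`_j * (box_gf R 1 L)`_(q - j) =
    'C(j + k, k)%:R.
  rewrite coef_box_gf // dvd1n muln1 (leq_ltn_trans (leq_subr _ _) qL) mulr1.
  by rewrite IH //; have := ltn_ord j; lia.
rewrite (eq_bigr _ (fun j _ => E j)) -natr_sum; congr _%:R.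
elim: q {qL E} => [|q IHq]; first by rewrite big_ord1 !add0n !binn.
by rewrite big_ord_recr /= IHq !addnS !addSn binS.
Qed.

(* With [D] a common multiple of the parts,
   prod_i 1/(1-x^{a_i}) = quot_gf / (1-x^D)^k. *)
Definition quot_gf (R : nzSemiRingType) (a : nat -> nat) (k D : nat) : {poly R} :=
  \prod_(i < k) box_gf R (a i.+1) (D %/ a i.+1).

Section Quotient.
Variables (a : nat -> nat) (N D : nat).
Hypothesis a_gt0 : forall i, (0 < i)%N -> (0 < a i)%N.
Hypothesis D_gt0 : (0 < D)%N.
Hypothesis a_dvd : forall i : 'I_N.+1, (a i.+1 %| D)%N.
Let b (j : nat) : nat := ((quot_gf nat a N.+1 D)`_j)%R.

Lemma coef_quot_gf (R : nzSemiRingType) j :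
  (quot_gf R a N.+1 D)`_j = (b j)%:R.
Proof.
rewrite /b /quot_gf; move: j.
apply: (big_rec2 (fun (p : {poly R}) (q : {poly nat}) =>
                    forall j, p`_j = (q`_j)%R%:R)) => [|i p q _ IH] j.
  by rewrite !coef1 natn.
rewrite !coefM natr_sum; apply: eq_bigr => s _.
by rewrite IH natrM !coef_box_gf ?a_gt0 //= natn.
Qed.

(** The factors have degree D - a_i < D, which gives this crude bound; it becomes the range [J] of
    the class sums. *)
Lemma quot_gf_high j : (N.+1 * D < j)%N -> b j = 0%N.
Proof.
move=> hj; apply: (@leq_sizeP nat _ j _) => //.
rewrite /quot_gf; apply: leq_trans hj.
suff H : forall n (F : 'I_n -> {poly nat}), (forall i, size (F i) <= D)%N ->
    (size (\prod_(i < n) F i)%R <= (n * D).+1)%N.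
  apply: H => i; apply/leq_sizeP => s hs; rewrite coef_box_gf ?a_gt0 //.
  by rewrite divnK ?a_dvd // ltnNge hs andbF.
elim=> [|n IH] F hF; first by rewrite big_ord0 size_poly1.
rewrite big_ord_recr /=; apply: leq_trans (size_polyMleq _ _) _.
have := IH (fun i => F (widen_ord (leqnSn n) i)) (fun i => hF _).
have := hF ord_max; rewrite mulSn; move: (size _) (size _) => u v; lia.
Qed.

(** Coefficient extraction from Q(x)/(1-x^D)^(N+1): the second factor is a series in x^D, so only j
    congruent to n contribute. The bound on [n] makes every n - j a genuine difference. *)
Lemma pA_quot n : (N.+1 * D <= n)%N ->
  pA a n N.+1 = (\sum_(j < (N.+1 * D).+1 | (j == n %[mod D])%N)
                   b j * 'C((n - j) %/ D + N, N))%N.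
Proof.
move=> hn; rewrite pA_coef.
(* Each truncation of 1/(1-x^(a_i)) is lengthened to n+1 blocks of length D, which changes nothing
   up to degree n and lets Q split off. *)
pose B := \prod_(i < N.+1) (box_gf nat (a i.+1) (D %/ a i.+1) * box_gf nat D n.+1).
have -> : (\prod_(i < N.+1) box_gf nat (a i.+1) n.+1)`_n = B`_n.
  apply: (@coef_prod_ext _ _ n) => // i s sn.
  have ai := a_gt0 (ltn0Sn i).
  have -> : box_gf nat (a i.+1) (D %/ a i.+1) * box_gf nat D n.+1
     = box_gf nat (a i.+1) (n.+1 * (D %/ a i.+1)).
    by rewrite -box_gf_mul divnK ?a_dvd.
  rewrite !coef_box_gf // -mulnA divnK ?a_dvd //.
  have s_lt c : (0 < c)%N -> (s < n.+1 * c)%N by move=> c0; rewrite (leq_trans _ (leq_pmulr _ c0)).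
  by rewrite !s_lt.
rewrite /B big_split /= prodr_const card_ord -/(quot_gf nat a N.+1 D).
have -> : box_gf nat D n.+1 ^+ N.+1 = (box_gf nat 1 n.+1 ^+ N.+1) \Po 'X^D.
  rewrite rmorphXn /=; congr (_ ^+ _).
  rewrite /box_gf raddf_sum /=; apply: eq_bigr => i _.
  by rewrite comp_Xn_poly -exprM muln1 mulnC.
rewrite coefM [RHS](big_ord_widen_cond n.+1
   (fun j => j == n %[mod D])%N (fun j => b j * 'C((n - j) %/ D + N, N))%N) //.
rewrite [RHS]big_mkcond; apply: eq_bigr => j _.
have jn : (j <= n)%N by have := ltn_ord j.
rewrite coef_comp_poly_Xn // -/(b j) -(eqn_mod_dvd _ jn) [(n == j %[mod D])%N]eq_sym.
have [jD|jD] := ltnP j (N.+1 * D).+1; last by rewrite quot_gf_high // mul0r andbF.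
rewrite andbT; case: ifP => _; last by rewrite mulr0.
rewrite coef_geom_exp ?natn // ltnS; apply: leq_trans (leq_div _ _) _; exact: leq_subr.
Qed.

Definition rising (R : nzSemiRingType) (x : R) : R := \prod_(i < N) (x + (i.+1 * D)%:R).

(** With n - j = qD, N! D^N C(q+N, N) is the product of the qD + iD for 1 <= i <= N, hence a
    polynomial in n - j. *)
Lemma pA_rising (R : nzRingType) n : (N.+1 * D <= n)%N ->
  (N`! * D ^ N * pA a n N.+1)%:R =
  \sum_(j < (N.+1 * D).+1 | (j == n %[mod D])%N)
      (b j)%:R * rising (n%:R - j%:R) :> R.
Proof.
move=> hn; rewrite pA_quot // big_distrr /= natr_sum; apply: eq_bigr => j jn.
have le_jn : (j <= n)%N by have := ltn_ord j; lia.
rewrite mulnCA natrM -natrB // /rising.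
under eq_bigr do rewrite -natrD.
rewrite -natr_prod; congr (_ * _%:R).
have /dvdnP[q ->] : (D %| n - j)%N by rewrite -eqn_mod_dvd // eq_sym.
rewrite mulnK // mulnAC [(N`! * _)%N]mulnC bin_ffact ffact_prod.
under [RHS]eq_bigr do rewrite -mulnDl.
rewrite big_split /= prod_nat_const card_ord; congr (_ * _)%N.
rewrite [LHS](reindex_inj rev_ord_inj) /=; apply: eq_bigr => i _.
by have := ltn_ord i; lia.
Qed.
End Quotient.

(** * Moments over residue classes *)

(** The operator x d/dx multiplies the j-th coefficient by j and lowers the order of a root by at
    most one; it is applied d times before evaluating at z. *)
Lemma sum_coef_root (F : fieldType) (z : F) (d S : nat) (p : {poly F}) :
  (size p <= S)%N -> ('X - z%:P) ^+ d.+1 %| p ->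
  \sum_(j < S) p`_j * j%:R ^+ d * z ^+ j = 0.
Proof.
elim: d p => [|d IH] p szp dvd_p.
  rewrite expr1 dvdp_XsubCl in dvd_p; rewrite -[RHS](eqP dvd_p) (horner_coef_wide _ szp).
  by apply: eq_bigr => j _; rewrite expr0 mulr1.
have coefE j : ('X * p^`())`_j = p`_j * j%:R.
  rewrite coefXM coef_deriv; case: j => [|j] /=; first by rewrite mulr0.
  by rewrite mulr_natr.
rewrite -[RHS](IH ('X * p^`())); last 2 first.
- by apply/leq_sizeP => j hj; rewrite coefE nth_default ?mul0r // (leq_trans szp).
- have /dvdpP[q ->] := dvd_p.
  rewrite dvdp_mull // derivM deriv_exp derivXsubC mul1r dvdp_add //.
    by rewrite dvdp_mull // dvdp_exp2l.
  by rewrite dvdp_mull // -mulr_natr dvdp_mulIl.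
by apply: eq_bigr => j _; rewrite coefE exprS mulrA.
Qed.

Section Moments.
Variables (a : nat -> nat) (N D : nat).
Hypothesis a_gt0 : forall i, (0 < i)%N -> (0 < a i)%N.
Hypothesis D_gt0 : (0 < D)%N.
Hypothesis a_dvd : forall i : 'I_N.+1, (a i.+1 %| D)%N.
Hypothesis a_gcd : gcd_cond a N.+1.
Let b (j : nat) : nat := ((quot_gf nat a N.+1 D)`_j)%R.

(** Otherwise D divides t a_i for some k-2 indices. Then D/gcd(t,D) divides all these a_i, hence
    their gcd 1, so D divides t, which 0 < t < D forbids. *)
Lemma card_nonfixed (t : nat) : (0 < t < D)%N ->
  (2 < #|[set i : 'I_N.+1 | ~~ (D %| t * a i.+1)%N]|)%N.
Proof.
move=> /andP[t0 tD]; rewrite ltnNge; apply/negP => small.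
pose T := [set i : 'I_N.+1 | (D %| t * a i.+1)%N].
have cT : (N.+1 - 2 <= #|T|)%N.
  have -> : T = ~: [set i : 'I_N.+1 | ~~ (D %| t * a i.+1)%N].
    by apply/setP => i; rewrite !inE negbK.
  by rewrite cardsCs setCK card_ord leq_sub2l.
have [S ST cS] : exists2 S : {set 'I_N.+1}, S \subset T & #|S| = (N.+1 - 2)%N.
  have /card_gt0P[S] : (0 < #|[set S : {set 'I_N.+1} | S \subset T & #|S| == (N.+1 - 2)%N]|)%N.
    by rewrite cards_draws bin_gt0.
  by rewrite inE => /andP[? /eqP ?]; exists S.
have /eqP := a_gcd cS; rewrite -dvdn1 => /(dvdn_trans _) H.
have g0 : (0 < gcdn t D)%N by rewrite gcdn_gt0 t0.
have : (D %/ gcdn t D %| 1)%N.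
  apply: H; apply/dvdn_biggcdP => i iS.
  have := subsetP ST _ iS; rewrite inE => Dt.
  have cop : coprime (D %/ gcdn t D) (t %/ gcdn t D).
    rewrite /coprime -(eqn_pmul2r g0) muln_gcdl !divnK ?dvdn_gcdl ?dvdn_gcdr //.
    by rewrite gcdnC mul1n.
  rewrite -(Gauss_dvdr _ cop) -(dvdn_pmul2r g0) divnK ?dvdn_gcdr //.
  by rewrite mulnAC divnK ?dvdn_gcdl.
rewrite dvdn1 => /eqP E.
have := divnK (dvdn_gcdr t D); rewrite E mul1n => gD.
by have := dvdn_leq t0 (dvdn_gcdl t D); rewrite gD leqNgt tD.
Qed.

(** A D-th root of unity w is a root of (1-x^D)/(1-x^(a_i)) as soon as w^(a_i) differs from 1; for w
    = z^t this happens for at least three i by [card_nonfixed]. *)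
Lemma quot_gf_triple_root (F : fieldType) (z : F) (t : nat) :
  D.-primitive_root z -> (0 < t < D)%N ->
  ('X - (z ^+ t)%:P) ^+ 3 %| quot_gf F a N.+1 D.
Proof.
move=> prim_z tD; rewrite /quot_gf.
pose S := [set i : 'I_N.+1 | ~~ (D %| t * a i.+1)%N].
rewrite (bigID (mem S)) /=; apply: dvdp_mulr.
apply: (@dvdp_trans _ (('X - (z ^+ t)%:P) ^+ #|S|)).
  by apply: dvdp_exp2l; exact: card_nonfixed.
rewrite -prodr_const; apply: (big_ind2 (fun p q : {poly F} => p %| q)) => //.
  by move=> p1 p2 q1 q2; exact: dvdp_mul.
move=> i; rewrite inE (prim_order_dvd prim_z) exprM => /negPf za1.
rewrite dvdp_XsubCl /root /box_gf horner_sum.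
have /eqP : ((z ^+ t) ^+ a i.+1) ^+ (D %/ a i.+1) - 1 = 0.
  by rewrite -exprM mulnC divnK // exprAC (prim_expr_order prim_z) expr1n subrr.
rewrite subrX1 mulf_eq0 subr_eq0 za1 /= => /eqP sum0; apply/eqP.
by rewrite -[RHS]sum0; apply: eq_bigr => c _; rewrite hornerXn mulnC exprM.
Qed.

(* Discrete Fourier transform over Z/D: the nontrivial frequencies of j^d b_j
   vanish for d <= 2 by the triple roots. *)
Lemma moment_residue (r d : nat) : (d <= 2)%N ->
  (D * \sum_(j < (N.+1 * D).+1 | (j == r %[mod D])%N) b j * j ^ d
   = \sum_(j < (N.+1 * D).+1) b j * j ^ d)%N.
Proof.
move=> d2; have [z prim_z] := C_prim_root_exists D_gt0.
set S := (N.+1 * D).+1.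
have zu : z \is a GRing.unit.
  by rewrite -(unitrX_pos _ D_gt0) (prim_expr_order prim_z) unitr1.
have dft (j : nat) : \sum_(t < D) (z ^+ t) ^+ j * (z ^+ t) ^- r = (D * (j == r %[mod D])%N)%:R.
  have E : \sum_(t < D) (z ^+ t) ^+ j * (z ^+ t) ^- r = \sum_(t < D) (z ^+ j / z ^+ r) ^+ t.
    by apply: eq_bigr => t _; rewrite exprMn exprVn -!exprM mulnC [(t * r)%N]mulnC.
  rewrite E -(eq_prim_root_expr prim_z); case: eqP => [->|zjr].
    rewrite divrr ?unitrX // muln1.
    under eq_bigr do rewrite expr1n.
    by rewrite sumr_const card_ord.
  have /eqP : (z ^+ j / z ^+ r) ^+ D - 1 = 0.
    by rewrite exprMn exprVn ![_ ^+ _ ^+ D]exprAC (prim_expr_order prim_z) !expr1n divr1 subrr.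
  rewrite subrX1 mulf_eq0 muln0 => /orP[|/eqP //].
  rewrite subr_eq0 => /eqP H; case: zjr.
  by rewrite -[LHS](divrK (unitrX r zu)) H mul1r.
apply/eqP; rewrite -(eqr_nat algC); apply/eqP.
have vanish (t : nat) : (0 < t < D)%N ->
    \sum_(j < S) (b j)%:R * j%:R ^+ d * (z ^+ t) ^+ j = 0.
  move=> tD; under eq_bigr do rewrite -(coef_quot_gf N D a_gt0).
  apply: sum_coef_root.
    by apply/leq_sizeP => j hj; rewrite (coef_quot_gf N D a_gt0) (quot_gf_high a_gt0 D_gt0 a_dvd).
  by apply: dvdp_trans (quot_gf_triple_root prim_z tD); apply: dvdp_exp2l.
transitivity (\sum_(t < D) (z ^+ t) ^- r * \sum_(j < S) (b j)%:R * j%:R ^+ d * (z ^+ t) ^+ j).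
  under [RHS]eq_bigr do rewrite mulr_sumr.
  rewrite exchange_big /= big_distrr big_mkcond natr_sum; apply: eq_bigr => j _.
  have -> : \sum_(t < D) z ^+ t ^- r * ((b j)%:R * j%:R ^+ d * z ^+ t ^+ j)
      = (b j)%:R * j%:R ^+ d * \sum_(t < D) z ^+ t ^+ j * z ^+ t ^- r.
    rewrite mulr_sumr; apply: eq_bigr => t _.
    by rewrite mulrCA; congr (_ * _); rewrite mulrC.
  rewrite dft; case: ifP => _; last by rewrite muln0 mulr0.
  by rewrite muln1 natrM !natrM natrX mulrC.
(* Only the frequency t = 0 survives, and it carries the full moment. *)
case: D D_gt0 vanish => // D' _ vanish.
rewrite big_ord_recl expr0 expr1n invr1 mul1r [X in _ + X]big1 ?addr0.
  by rewrite natr_sum; apply: eq_bigr => j _; rewrite expr1n mulr1 natrM natrX.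
by move=> t _; rewrite vanish ?mulr0 //= ltnS ltn_ord.
Qed.
End Moments.

(** * Products of linear factors *)

Section Products.
Variable R : realFieldType.

(** Induction via (1-cx)(1+c(S+x)) = 1 + cS - c^2 x(S+x). The sign of [c] is left free, since it
    will be m + d with d of either sign. *)
Lemma prod_1B_mul_1D_le1 n (c : R) (s : 'I_n -> R) :
  (forall i, 0 <= s i) -> (forall i, c * s i <= 1) ->
  (\prod_(i < n) (1 - c * s i)) * (1 + c * \sum_(i < n) s i) <= 1.
Proof.
elim: n s => [|n IH] s s0 cs; first by rewrite !big_ord0 mulr0 addr0 mulr1.
rewrite !big_ord_recr /=.
have {IH} := IH (fun i => s (widen_ord (leqnSn n) i)) (fun i => s0 _) (fun i => cs _).
set P := \prod_(i < n) _; set S := \sum_(i < n) _ => IH.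
have P0 : 0 <= P by apply: prodr_ge0 => i _; rewrite subr_ge0.
have S0 : 0 <= S by apply: sumr_ge0.
have x0 := s0 ord_max; set x := s ord_max in x0 *.
apply: le_trans IH; rewrite -mulrA ler_wpM2l //.
have : 0 <= c ^+ 2 * (x * (S + x)) by rewrite mulr_ge0 ?sqr_ge0 // mulr_ge0 ?addr_ge0.
nra.
Qed.

(* Each factor satisfies (x + m)(y - m) = xy - m(m + d) with d = x - y. *)
Lemma prod_exchange_le n (x y : 'I_n -> R) (m d : R) :
  0 < m -> (forall i, m <= x i) -> (forall i, m <= y i) ->
  (forall i, x i - y i = d) ->
  (\prod_(i < n) (x i + m)) * (\prod_(i < n) (y i - m)) *
    (1 + (m + d) * \sum_(i < n) m / (x i * y i)) <=
  (\prod_(i < n) x i) * (\prod_(i < n) y i).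
Proof.
move=> m0 mx my xyd; rewrite -!big_split /=.
have xy0 i : 0 < x i * y i.
  by rewrite mulr_gt0 // (lt_le_trans m0).
have E i : (x i + m) * (y i - m) = x i * y i * (1 - (m + d) * (m / (x i * y i))).
  have xn : x i != 0 by rewrite gt_eqF ?(lt_le_trans m0).
  have yn : y i != 0 by rewrite gt_eqF ?(lt_le_trans m0).
  by rewrite -(xyd i); field; rewrite ?xn ?yn.
under eq_bigr do rewrite E.
rewrite big_split /= -mulrA -[leRHS]mulr1 ler_wpM2l //.
  by apply: prodr_ge0 => i _; exact: ltW.
apply: prod_1B_mul_1D_le1 => i; first by rewrite divr_ge0 // ltW.
have : 0 <= (x i + m) * (y i - m).
  by rewrite mulr_ge0 ?subr_ge0 // addr_ge0 ?(ltW m0) // (le_trans _ (mx i)) // ltW.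
by rewrite E pmulr_rge0 // subr_ge0.
Qed.

(** With t = mS and e = dS, [prod_exchange_le] for d and -d bounds the two products by H/(1+t+e) and
    H/(1+t-e). In their sum 2H(1+t)/((1+t)^2-e^2) the first-order effect of e cancels. *)
Lemma prod_exchange_pair_le n (x y : 'I_n -> R) (m d g : R) :
  0 < m -> (forall i, m <= x i) -> (forall i, m <= y i) ->
  (forall i, x i - y i = d) ->
  let S := \sum_(i < n) m / (x i * y i) in
  S * d ^+ 2 <= m / 2 -> 0 <= g <= 1 / 12 -> 3 * g <= m * S ->
  (\prod_(i < n) (x i + m)) * (\prod_(i < n) (y i - m)) +
  (\prod_(i < n) (x i - m)) * (\prod_(i < n) (y i + m))
  <= 2 * (1 - g) * ((\prod_(i < n) x i) * (\prod_(i < n) y i)).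
Proof.
move=> m0 mx my xyd S Sd /andP[g0 g12] gS.
have := prod_exchange_le m0 mx my xyd; rewrite -/S.
have := @prod_exchange_le n y x m (- d) m0 my mx.
have -> : \sum_(i < n) m / (y i * x i) = S by apply: eq_bigr => i _; rewrite mulrC [y i * _]mulrC mulrC.
rewrite [(\prod_(i < n) y i) * _]mulrC [(\prod_(i < n) (y i + m)) * _]mulrC.
set H := _ * (\prod_(i < n) y i).
set P1 := _ * (\prod_(i < n) (y i - m)); set P2 := _ * (\prod_(i < n) (y i + m)).
have yxd i : y i - x i = - d by rewrite -(xyd i) opprB.
move=> /(_ yxd) h2 h1.
have S0 : 0 <= S by apply: sumr_ge0 => i _; rewrite divr_ge0 ?(ltW m0) // mulr_ge0 // (le_trans (ltW m0)).
have H0 : 0 <= H by apply: mulr_ge0; apply: prodr_ge0 => i _; rewrite (le_trans (ltW m0)).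
set t := m * S in gS *; set e := d * S.
have t0 : 0 <= t by rewrite /t mulr_ge0 // ltW.
have et : e ^+ 2 <= t / 2.
  have := ler_wpM2r S0 Sd; rewrite /e /t; nra.
have h1' : P1 * (1 + t + e) <= H by move: h1; rewrite /t /e mulrDl addrA.
have h2' : P2 * (1 + t - e) <= H by move: h2; rewrite /t /e mulrDl addrA mulNr.
have K0 : 0 < (1 + t) ^+ 2 - e ^+ 2 by nra.
have ep : 0 <= 1 + t + e by nra.
have en : 0 <= 1 + t - e by nra.
rewrite -(ler_pM2r K0).
have A1 := ler_wpM2r en h1'; have A2 := ler_wpM2r ep h2'.
(* As e^2 <= t/2, the right side is at least (1-g)(1+3t/2); g <= t/3 and g <= 1/12 then suffice. *)
have B : 1 + t <= (1 - g) * ((1 + t) ^+ 2 - e ^+ 2) by nra.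
have := ler_wpM2l H0 B.
nra.
Qed.

(** The witnesses are the elementary symmetric functions of degrees n, n-1, n-2 in the c_i; each
    factor omitted from the full product costs at most 1/z. *)
Lemma prod_subr_taylor n (c : 'I_n -> R) (z : R) : 0 < z -> (forall i, z <= c i) ->
  exists e0 e1 e2 : R, forall j, 0 <= j <= z ->
    0 <= e0 - e1 * j + e2 * j ^+ 2 - \prod_(i < n) (c i - j)
      <= j ^+ 3 * 'C(n, 3)%:R * (\prod_(i < n) c i) / z ^+ 3.
Proof.
move=> z0 zc.
(* The induction must carry the bounds on e1 and e2: with a further factor x - j, the new remainder
   is (x-j) times the old one plus e2 j^3. *)
suff [e1 [e2 [_ [_ H]]]] : exists e1 e2 : R,
    0 <= e1 <= n%:R * (\prod_(i < n) c i) / z /\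
    0 <= e2 <= 'C(n, 2)%:R * (\prod_(i < n) c i) / z ^+ 2 /\
    forall j, 0 <= j <= z ->
    0 <= (\prod_(i < n) c i) - e1 * j + e2 * j ^+ 2 - \prod_(i < n) (c i - j)
      <= j ^+ 3 * 'C(n, 3)%:R * (\prod_(i < n) c i) / z ^+ 3.
  by exists (\prod_(i < n) c i), e1, e2.
elim: n c zc => [|n IH] c zc.
  exists 0, 0; rewrite !bin0n /= !mul0r lexx; do 2!split=> //.
  by move=> j _; rewrite !big_ord0 mulr0 !mul0r subr0 addr0 subrr lexx.
have {IH} := IH (fun i => c (widen_ord (leqnSn n) i)) (fun i => zc _).
rewrite big_ord_recr /=; set P := \prod_(i < n) _; set x := c ord_max.
have zx : z <= x := zc ord_max.
have P0 : 0 <= P by apply: prodr_ge0 => i _; rewrite (le_trans (ltW z0)).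
have q0 : 0 < z^-1 by rewrite invr_gt0.
have qx : 1 <= x * z^-1 by rewrite ler_pdivlMr // mul1r.
rewrite -!exprVn; set q := z^-1 in q0 qx * => -[e1 [e2 [/andP[e10 e11] [/andP[e20 e21] H]]]].
have Pq : 0 <= P * q by rewrite mulr_ge0 // ltW.
have Pqq : 0 <= P * q ^+ 2 by rewrite mulr_ge0 // exprn_ge0 // ltW.
have x0 : 0 <= x by rewrite (le_trans (ltW z0)).
exists (x * e1 + P), (x * e2 + e1); split; [|split].
- rewrite addr_ge0 ?mulr_ge0 //= -natr1.
  have := ler_wpM2l x0 e11; have := ler_wpM2l P0 qx; nra.
- rewrite addr_ge0 ?mulr_ge0 //= binS bin1 natrD.
  have := ler_wpM2l x0 e21; have := ler_wpM2l (mulr_ge0 (ler0n R n) Pq) qx; nra.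
- move=> j /andP[j0 jz]; have /andP[H1 H2] := H j (introT andP (conj j0 jz)).
  rewrite !big_ord_recr /= -/x; move: H1 H2; set Q := \prod_(i < n) (_ - j) => H1 H2.
  have xj : 0 <= x - j by rewrite subr_ge0 (le_trans jz).
  have j30 : 0 <= j ^+ 3 by rewrite exprn_ge0.
  have A1 := mulr_ge0 xj H1; have A2 := mulr_ge0 e20 j30.
  have A3 := ler_wpM2r j30 e21.
  have A4 := ler_wpM2l x0 H2.
  have A5 := mulr_ge0 j0 H1.
  have A6 := ler_wpM2l (mulr_ge0 (mulr_ge0 j30 (ler0n R 'C(n, 2))) Pqq) qx.
  apply/andP; split; first nra.
  rewrite binS natrD; nra.
Qed.

(** Bernoulli's inequality in product form: each factor loses at most the fraction j/z. *)
Lemma prod_subr_ge n (c : 'I_n -> R) (z j : R) : 0 < z -> 0 <= j <= z ->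
  (forall i, z <= c i) ->
  (1 - n%:R * (j / z)) * (\prod_(i < n) c i) <= \prod_(i < n) (c i - j).
Proof.
move=> z0 /andP[j0 jz]; elim: n c => [|n IH] c zc.
  by rewrite !big_ord0 mul0r subr0 mulr1.
have {IH} := IH (fun i => c (widen_ord (leqnSn n) i)) (fun i => zc _).
rewrite !big_ord_recr /=; set P := \prod_(i < n) _; set Q := \prod_(i < n) _.
set x := c ord_max; have zx : z <= x := zc ord_max.
have P0 : 0 <= P by apply: prodr_ge0 => i _; rewrite (le_trans (ltW z0)).
have Q0 : 0 <= Q by apply: prodr_ge0 => i _; rewrite subr_ge0 (le_trans jz).
have QP : Q <= P.
  by apply: ler_prod => i _; rewrite subr_ge0 (le_trans jz) //= gerBl.
have w0 : 0 <= j / z by rewrite divr_ge0 // ltW.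
have jw : j <= j / z * x.
  by rewrite mulrAC -mulrA ler_peMr // ler_pdivlMr // mul1r.
move: w0 jw; set w := j / z => w0 jw.
have x0 : 0 <= x by rewrite (le_trans (ltW z0)).
rewrite -natr1 => IH.
have A1 := ler_wpM2r x0 IH.
have A2 := ler_wpM2r P0 jw.
have A3 := ler_wpM2r j0 QP.
nra.
Qed.
End Products.

(** * Sums over residue classes *)

Section ClassSums.
Variables (R : realFieldType) (N D J : nat) (b : nat -> nat).
Hypothesis D_gt0 : (0 < D)%N.
Hypothesis moments : forall r d : nat, (d <= 2)%N ->
  (D * \sum_(j < J.+1 | (j == r %[mod D])%N) b j * j ^ d
   = \sum_(j < J.+1) b j * j ^ d)%N.
Hypothesis b_gt0 : (0 < \sum_(j < J.+1) b j)%N.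

Definition class_sum (r : nat) (f : R -> R) : R :=
  \sum_(j < J.+1 | (j == r %[mod D])%N) (b j)%:R * f j%:R.

Lemma class_sum_monomial r r' d : (d <= 2)%N ->
  class_sum r (fun x => x ^+ d) = class_sum r' (fun x => x ^+ d).
Proof.
move=> d2.
have H s : class_sum s (fun x => x ^+ d) =
    (\sum_(j < J.+1 | (j == s %[mod D])%N) b j * j ^ d)%N%:R.
  by rewrite natr_sum; apply: eq_bigr => j _; rewrite natrM natrX.
rewrite !H; congr _%:R; apply/eqP; rewrite -(eqn_pmul2l D_gt0).
by rewrite !moments.
Qed.

Lemma class_sum_quadratic r r' (e0 e1 e2 : R) :
  class_sum r (fun x => e0 - e1 * x + e2 * x ^+ 2) =
  class_sum r' (fun x => e0 - e1 * x + e2 * x ^+ 2).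
Proof.
have H s : class_sum s (fun x => e0 - e1 * x + e2 * x ^+ 2) =
   e0 * class_sum s (fun x => x ^+ 0) - e1 * class_sum s (fun x => x ^+ 1)
   + e2 * class_sum s (fun x => x ^+ 2).
  rewrite /class_sum !mulr_sumr -sumrN -!big_split; apply: eq_bigr => j _ /=.
  by rewrite expr0 expr1; ring.
by rewrite !H; do !congr (_ + _); do ?congr (- _); congr (_ * _); apply: class_sum_monomial.
Qed.

Lemma ler_class_sum r (f g : R -> R) :
  (forall x, 0 <= x <= J%:R -> f x <= g x) -> class_sum r f <= class_sum r g.
Proof.
move=> fg; apply: ler_sum => j _; rewrite ler_wpM2l ?ler0n //.
by apply: fg; rewrite ler0n ler_nat -ltnS ltn_ord.
Qed.

Lemma class_sumZ r (c : R) f : class_sum r (fun x => c * f x) = c * class_sum r f.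
Proof. by rewrite /class_sum mulr_sumr; apply: eq_bigr => j _; rewrite mulrCA. Qed.

Lemma class_sumB r (f g : R -> R) :
  class_sum r (fun x => f x - g x) = class_sum r f - class_sum r g.
Proof. by rewrite /class_sum -sumrB; apply: eq_bigr => j _; rewrite mulrBr. Qed.

Lemma class_sum1_gt0 r : 0 < class_sum r (fun=> 1).
Proof.
have -> : class_sum r (fun=> 1) =
    (\sum_(j < J.+1 | (j == r %[mod D])%N) b j * j ^ 0)%N%:R.
  by rewrite natr_sum; apply: eq_bigr => j _; rewrite muln1 mulr1.
rewrite ltr0n -(ltn_pmul2l D_gt0) muln0 moments //.
by under eq_bigr do rewrite muln1.
Qed.

Lemma class_sum_const r (c : R) : class_sum r (fun=> c) = c * class_sum r (fun=> 1).
Proof. by rewrite -class_sumZ; apply: eq_bigr => j _; rewrite mulr1. Qed.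

(* Changing the residue class only affects the cubic Taylor remainder. *)
Lemma class_sum_change (n : nat) (c : 'I_n -> R) (z : R) r r' :
  0 < z -> J%:R <= z -> (forall i, z <= c i) -> n%:R * J%:R <= (3 / 5) * z ->
  class_sum r (fun x => \prod_(i < n) (c i - x)) <=
  (1 + 5 / 2 * 'C(n, 3)%:R * J%:R ^+ 3 / z ^+ 3) *
  class_sum r' (fun x => \prod_(i < n) (c i - x)).
Proof.
move=> z0 Jz zc nJ; set f := fun x => \prod_(i < n) (c i - x).
have [e0 [e1 [e2 H]]] := prod_subr_taylor z0 zc.
set q := fun x : R => e0 - e1 * x + e2 * x ^+ 2.
set K := J%:R ^+ 3 * 'C(n, 3)%:R * (\prod_(i < n) c i) / z ^+ 3.
have lr : class_sum r f <= class_sum r' q.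
  rewrite -(class_sum_quadratic r); apply: ler_class_sum => x /andP[x0 xJ].
  have /H/andP[h _] : 0 <= x <= z by rewrite x0 (le_trans xJ).
  by rewrite -subr_ge0.
have c0 : 0 <= \prod_(i < n) c i by apply: prodr_ge0 => i _; rewrite (le_trans (ltW z0)).
have lr' : class_sum r' q - K * class_sum r' (fun=> 1) <= class_sum r' f.
  rewrite -class_sum_const -class_sumB; apply: ler_class_sum => x /andP[x0 xJ].
  have /H/andP[_ h] : 0 <= x <= z by rewrite x0 (le_trans xJ).
  rewrite lerBlDr -lerBlDl; apply: le_trans h _.
  rewrite /K ler_wpM2r ?invr_ge0 ?exprn_ge0 ?(ltW z0) // ler_wpM2r //.
  by rewrite ler_wpM2r // lerXn2r // nnegrE.
(* Since nJ/z <= 3/5, at least 2/5 of the product remains. This turns the absolute error K into a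
   relative one, whence the constant 5/2. *)
have low : (2 / 5 * \prod_(i < n) c i) * class_sum r' (fun=> 1) <= class_sum r' f.
  rewrite -class_sum_const; apply: ler_class_sum => x /andP[x0 xJ].
  have xz : 0 <= x <= z by rewrite x0 (le_trans xJ).
  apply: le_trans (prod_subr_ge z0 xz zc); rewrite ler_wpM2r //.
  suff : n%:R * (x / z) <= 3 / 5 by lra.
  rewrite mulrA ler_pdivrMr //; apply: le_trans nJ.
  by rewrite ler_wpM2l.
have k0 : 0 <= 5 / 2 * 'C(n, 3)%:R * J%:R ^+ 3 / z ^+ 3.
  by rewrite !mulr_ge0 ?invr_ge0 ?exprn_ge0 ?(ltW z0) //; lra.
have := ler_wpM2l k0 low.
set M := class_sum r' (fun=> 1) in lr' *.
have -> : 5 / 2 * 'C(n, 3)%:R * J%:R ^+ 3 / z ^+ 3 * (2 / 5 * \prod_(i < n) c i * M) = K * M.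
  by rewrite /K; field; rewrite gt_eqF.
lra.
Qed.

Variables (n m : R).
Hypothesis N_ge3 : (3 <= N)%N.
Hypothesis J_gt0 : (0 < J)%N.
Hypothesis ND_J : (N * D <= J)%N.
Hypothesis m_gt0 : 0 < m.
Hypothesis n_ge3m : 3 * m <= n.
Hypothesis n_ge : 5 / 2 * N%:R * J%:R <= n.
Hypothesis nm2_ge : 48 * 'C(N, 3)%:R * J%:R ^+ 3 <= n * m ^+ 2.

Let h (y : R) : R := rising N D y.

Let n_gt0 : 0 < n. Proof. by move: m_gt0 n_ge3m; lra. Qed.
Let N3 : 3 <= N%:R :> R. Proof. by rewrite (ler_nat R 3 N). Qed.
Let J1 : 1 <= J%:R :> R. Proof. by rewrite ler1n. Qed.
Let nJ : 15 / 2 * J%:R <= n. Proof. by move: n_ge N3 J1; nra. Qed.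

Let risingE (z x : R) : h (z - x) = \prod_(i < N) (z + (i.+1 * D)%:R - x).
Proof. by apply: eq_bigr => i _; rewrite addrAC. Qed.

(** As 3m <= n, this range of z contains n + m and n - m. The constant 9 rounds up (5/2)(3/2)^3 =
    135/16. *)
Lemma rising_class_change r r' z : 2 / 3 * n <= z ->
  class_sum r (fun x => h (z - x)) <=
  (1 + 9 * 'C(N, 3)%:R * J%:R ^+ 3 / n ^+ 3) * class_sum r' (fun x => h (z - x)).
Proof.
have [[n0 J0] [nJ' nNJ]] := ((n_gt0, J1), (nJ, n_ge)); move=> nz; have z0 : 0 < z by lra.
have E s : class_sum s (fun x => h (z - x)) =
    class_sum s (fun x => \prod_(i < N) (z + (i.+1 * D)%:R - x)).
  by apply: eq_bigr => j _; rewrite risingE.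
have Jz : J%:R <= z by lra.
have h0 x : 0 <= x <= J%:R -> 0 <= \prod_(i < N) (z + (i.+1 * D)%:R - x).
  move=> /andP[_ xJ]; apply: prodr_ge0 => i _.
  by rewrite subr_ge0 (le_trans xJ) // (le_trans Jz) // lerDl.
have := @class_sum_change N (fun i => z + (i.+1 * D)%:R) z r r' z0 Jz.
rewrite /= -!E => /(_ _ _)H; apply: (le_trans (H _ _)).
- by move=> i; rewrite lerDl.
- lra.
rewrite ler_wpM2r //.
  by rewrite E -(mul0r (class_sum r' (fun=> 1))) -class_sum_const; exact: ler_class_sum.
rewrite lerD2l -!mulrA.
have z3 : 8 / 27 * n ^+ 3 <= z ^+ 3.
  have -> : 8 / 27 * n ^+ 3 = (2 / 3 * n) ^+ 3 by field.
  by rewrite lerXn2r // nnegrE; lra.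
have n30 : 0 < n ^+ 3 by rewrite exprn_gt0.
have z30 : 0 < z ^+ 3 by rewrite exprn_gt0.
have inv : 5 / 2 / z ^+ 3 <= 9 / n ^+ 3.
  by rewrite ler_pdivrMr // mulrAC ler_pdivlMr //; lra.
have C0 : 0 <= 'C(N, 3)%:R * J%:R ^+ 3 :> R by rewrite mulr_ge0 ?exprn_ge0.
have := ler_wpM2l C0 inv; lra.
Qed.

(** All factors u + iD and v + iD lie between n - J and n + J, so S is close to Nm/n^2 and mS to
    N(m/n)^2. With N >= 3 this allows g = (3/4)(m/n)^2, which is at most 1/12 because 3m <= n. *)
Lemma rising_exchange (u v : R) : n - J%:R <= u <= n -> n - J%:R <= v <= n ->
  h (u + m) * h (v - m) + h (u - m) * h (v + m) <=
  2 * (1 - 3 / 4 * (m / n) ^+ 2) * (h u * h v).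
Proof.
have [[n0 m0] [n3m nJ']] := ((n_gt0, m_gt0), (n_ge3m, nJ)).
have [[J0 nNJ] N3'] := ((J1, n_ge), N3).
move=> /andP[u1 u2] /andP[v1 v2].
have addN (x w : R) : h (x + w) = \prod_(i < N) (x + (i.+1 * D)%:R + w).
  by apply: eq_bigr => i _; rewrite addrAC.
have up (i : 'I_N) : 0 <= ((i.+1 * D)%:R : R) <= J%:R.
  by rewrite ler0n ler_nat (leq_trans _ ND_J) // leq_mul2r ltn_ord orbT.
set g := 3 / 4 * (m / n) ^+ 2.
have t0 : 0 <= m / n by rewrite divr_ge0 // ltW.
have t3 : m / n <= 1 / 3 by rewrite ler_pdivrMr //; lra.
have mn : m = m / n * n by rewrite divfK // gt_eqF.
rewrite !addN.
apply: (@prod_exchange_pair_le R N (fun i => u + (i.+1 * D)%:R)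
   (fun i => v + (i.+1 * D)%:R) m (u - v) g) => //.
- by move=> i; have /andP[] := up i; lra.
- by move=> i; have /andP[] := up i; lra.
- by move=> i; ring.
- have d2 : (u - v) ^+ 2 <= J%:R ^+ 2 by rewrite -(real_normK (num_real _)) lerXn2r ?nnegrE // ler_norml; lra.
  have S1 : \sum_(i < N) m / ((u + (i.+1 * D)%:R) * (v + (i.+1 * D)%:R)) <= N%:R * (m / (n - J%:R) ^+ 2).
    rewrite mulr_natl -[X in _ *+ X]card_ord -sumr_const; apply: ler_sum => i _.
    rewrite ler_wpM2l ?(ltW m_gt0) // lef_pV2 ?posrE; have /andP[] := up i => i1 i2; [|nra|nra].
    by rewrite expr2 ler_pM //; lra.
  apply: le_trans (ler_pM _ _ S1 d2) _; rewrite ?sqr_ge0 //.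
    apply: sumr_ge0 => i _; rewrite divr_ge0 ?(ltW m_gt0) //; have /andP[] := up i; nra.
  rewrite -mulrA mulrAC mulrA ler_pdivrMr; last by rewrite exprn_gt0 //; lra.
  have : N%:R * J%:R ^+ 2 <= (n - J%:R) ^+ 2 / 2 by nra.
  by move/(ler_wpM2l (ltW m_gt0)); lra.
- by rewrite /g; apply/andP; split; nra.
have S2 : N%:R * (m / (n + J%:R) ^+ 2) <=
    \sum_(i < N) m / ((u + (i.+1 * D)%:R) * (v + (i.+1 * D)%:R)).
  rewrite mulr_natl -[X in _ *+ X]card_ord -sumr_const; apply: ler_sum => i _.
  rewrite ler_wpM2l ?(ltW m_gt0) // lef_pV2 ?posrE; have /andP[] := up i => i1 i2; [|nra|nra].
  by rewrite expr2 ler_pM //; lra.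
apply: le_trans (ler_wpM2l (ltW m_gt0) S2).
have p0 : 0 < (n + J%:R) ^+ 2 by rewrite exprn_gt0 //; lra.
have -> : m * (N%:R * (m / (n + J%:R) ^+ 2)) = N%:R * m ^+ 2 / (n + J%:R) ^+ 2 by ring.
rewrite ler_pdivlMr //.
(* From J <= 2n/15, as (17/15)^2 < 4/3; this is the source of the 3/4 in g. *)
have : (n + J%:R) ^+ 2 <= 4 / 3 * n ^+ 2 by nra.
move/(ler_wpM2l (sqr_ge0 (m / n))).
have -> : (m / n) ^+ 2 * (4 / 3 * n ^+ 2) = 4 / 3 * m ^+ 2.
  by rewrite [in RHS]mn; ring.
rewrite /g; have := ler_wpM2r (sqr_ge0 m) N3; lra.
Qed.

Lemma class_sum_rising_log_concave r r' r'' :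
  class_sum r (fun x => h (n + m - x)) * class_sum r' (fun x => h (n - m - x)) <
  class_sum r'' (fun x => h (n - x)) ^+ 2.
Proof.
have [[n0 m0] [n3m nJ']] := ((n_gt0, m_gt0), (n_ge3m, nJ)).
have [J0 nm2] := (J1, nm2_ge).
set e := 9 * 'C(N, 3)%:R * J%:R ^+ 3 / n ^+ 3.
set g := 3 / 4 * (m / n) ^+ 2.
have h_ge0 y : 0 <= y -> 0 <= h y.
  by move=> y0; apply: prodr_ge0 => i _; rewrite addr_ge0.
have A0 : 0 < class_sum r'' (fun x => h (n - x)).
  have c0 : 0 < h (n - J%:R) by apply: prodr_gt0 => i _; rewrite ltr_wpDr //; lra.
  apply: lt_le_trans (_ : h (n - J%:R) * class_sum r'' (fun=> 1) <= _).
    by rewrite mulr_gt0 // class_sum1_gt0.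
  rewrite -class_sum_const; apply: ler_class_sum => x /andP[x0 xJ].
  by apply: ler_prod => i _; have := ler0n R (i.+1 * D); lra.
have t0 : 0 < m / n by rewrite divr_gt0.
have t3 : m / n <= 1 / 3 by rewrite ler_pdivrMr //; lra.
have mn : m = m / n * n by rewrite divfK // gt_eqF.
have e0 : 0 <= e by rewrite /e !mulr_ge0 ?invr_ge0 ?exprn_ge0 ?(ltW n_gt0) //; lra.
(* By [nm2_ge], with 9/48 = 3/16. *)
have eg : e <= 3 / 16 * (m / n) ^+ 2.
  rewrite /e ler_pdivrMr ?exprn_gt0 //.
  have -> : 3 / 16 * (m / n) ^+ 2 * n ^+ 3 = 3 / 16 * (n * m ^+ 2).
    by rewrite [in RHS]mn; ring.
  lra.
have C1 := @rising_class_change r r'' (n + m) ltac:(lra).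
have C2 := @rising_class_change r' r'' (n - m) ltac:(lra).
rewrite -/e in C1 C2.
have nonneg s z : J%:R <= z -> 0 <= class_sum s (fun x => h (z - x)).
  move=> Jz; have := @ler_class_sum s (fun=> 0) (fun x => h (z - x)).
  rewrite class_sum_const mul0r; apply=> x /andP[x0 xJ]; apply: h_ge0; lra.
apply: le_lt_trans (ler_pM (nonneg _ _ _) (nonneg _ _ _) C1 C2) _; [lra|lra|].
set B := class_sum r'' _; set C := class_sum r'' (fun x => h (n - m - x)).
have BC : B * C <= (1 - g) * class_sum r'' (fun x => h (n - x)) ^+ 2.
  suff : 2 * (B * C) <= 2 * (1 - g) * class_sum r'' (fun x => h (n - x)) ^+ 2 by lra.
  (* Expanding BC + CB as a double sum symmetrises it in the two indices, so that [rising_exchange]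
     applies term by term. *)
  rewrite mulr_natl mulr2n {2}[B * C]mulrC /B /C /class_sum expr2 !big_distrlr /=.
  rewrite -big_split /= mulr_sumr; apply: ler_sum => i _.
  rewrite -big_split /= mulr_sumr; apply: ler_sum => j _.
  have bnd (l : 'I_J.+1) : n - J%:R <= n - l%:R <= n.
    have : 0 <= (l%:R : R) <= J%:R by rewrite ler0n ler_nat -ltnS ltn_ord.
    lra.
  have bb : 0 <= (b i)%:R * (b j)%:R :> R by rewrite mulr_ge0.
  have := ler_wpM2l bb (rising_exchange (bnd i) (bnd j)); rewrite -/g.
  have E1 (l : 'I_J.+1) : n + m - l%:R = n - l%:R + m by ring.
  have E2 (l : 'I_J.+1) : n - m - l%:R = n - l%:R - m by ring.
  by rewrite !E1 !E2; lra.
have A2 : 0 < class_sum r'' (fun x => h (n - x)) ^+ 2 by rewrite exprn_gt0.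
move: BC A2; set A := class_sum r'' _ ^+ 2 => BC A2.
have ee : 0 <= (1 + e) ^+ 2 by rewrite sqr_ge0.
have := ler_wpM2l ee BC.
(* The two class changes cost at most 1 + t^2/2 with t = m/n, less than the gain (3/4)t^2. *)
suff : (1 + e) ^+ 2 * (1 - g) < 1 by nra.
rewrite /g; move: eg t0 t3; set t := m / n => eg t0 t3.
have t2 : 0 < t ^+ 2 by rewrite exprn_gt0.
have t9 : t ^+ 2 <= 1 / 9 by nra.
have : (1 + e) ^+ 2 <= 1 + 1 / 2 * t ^+ 2 by nra.
nra.
Qed.
End ClassSums.

(** * The restricted partition function *)

Lemma quot_gf_coef0 (a : nat -> nat) (k D : nat) :
  (forall i, (0 < i)%N -> (0 < a i)%N) -> (0 < D)%N ->
  (forall i : 'I_k, (a i.+1 %| D)%N) -> (quot_gf nat a k D)`_0 = 1%N.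
Proof.
move=> a0 D0 aD; apply: (big_ind (fun p : {poly nat} => p`_0 = 1%N)).
- by rewrite coef1.
- by move=> p q p0 q0; rewrite coefM big_ord1 subnn p0 q0.
by move=> i _; rewrite coef_box_gf ?a0 // dvdn0 divnK ?aD // D0.
Qed.

(** With J = (N+1)D, the bounds 6 C(N,3) <= N! and (N+1) J^3 <= J^(N+1) give 12 C(N,3) (N+1) J^3 <=
    n m^2, and N+1 >= 4 yields 48. The second claim is proved for cubes, using 9 n m^2 <= n^3. *)
Lemma parameter_bounds (N D n m : nat) : (3 <= N)%N -> (0 < D)%N -> (3 * m <= n)%N ->
  (2 * (N`! * (D * N.+1) ^ N.+1) <= n * m ^ 2)%N ->
  (48 * 'C(N, 3) * (N.+1 * D) ^ 3 <= n * m ^ 2)%N /\ (5 * N * (N.+1 * D) <= 2 * n)%N.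
Proof.
move=> N3 D0 mn H.
have F : (6 * 'C(N, 3) <= N`!)%N.
  by rewrite -(bin_fact N3) [(3`! * _)%N]mulnC mulnA mulnC leq_mul2r /= leq_pmulr ?fact_gt0.
have P : (N.+1 * (D * N.+1) ^ 3 <= (D * N.+1) ^ N.+1)%N.
  apply: leq_trans (_ : (D * N.+1) ^ 4 <= _)%N; last by rewrite leq_pexp2l ?muln_gt0 ?D0.
  by rewrite [X in (_ <= X)%N]expnS leq_mul2r leq_pmull ?orbT.
have Q := leq_mul F P.
rewrite [(D * _)%N]mulnC in Q H.
set J := (N.+1 * D)%N in Q H *.
split.
  have : ('C(N, 3) * J ^ 3 * 4 <= 'C(N, 3) * J ^ 3 * N.+1)%N by rewrite leq_mul2l ltnS N3 orbT.
  by move: Q H; set J3 := (J ^ 3)%N; set c := 'C(N, 3); lia.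
have cb : (6 * 'C(N, 3) = N * (N.-1 * N.-2))%N.
  by rewrite mulnC (_ : 6 = 3`!)%N // bin_ffact !ffactnS ffactn0 muln1.
have n3 : (9 * (n * m ^ 2) <= n ^ 3)%N.
  by rewrite (expnS n 2) mulnCA leq_mul2l -[9%N]/(3 ^ 2)%N -expnMn leq_exp2r // mn orbT.
suff : ((5 * N * J) ^ 3 <= (2 * n) ^ 3)%N by rewrite leq_exp2r.
(* 125 = 5^3 and 144 = 8 * 9 * 2, where 12 C(N,3) = 2N(N-1)(N-2). The case N = 3 is tight: 1125 <=
   1152. *)
have key : (125 * N ^ 2 <= 144 * (N.-1 * N.-2 * N.+1))%N.
  case: N N3 {H F P Q cb J} => [|[|[|N]]] // _ /=; rewrite !expnS expn0; nia.
have := leq_mul key (leqnn (N * J ^ 3)).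
rewrite cb in Q; rewrite !expnMn.
move: Q H n3; set J3 := (J ^ 3)%N; set n3 := (n ^ 3)%N; set X := (n * m ^ 2)%N.
rewrite (expnS N 2); set N2 := (N ^ 2)%N; lia.
Qed.

Lemma pA_log_concave_of_large (a : nat -> nat) (N n m : nat) :
  (forall i, (0 < i)%N -> (0 < a i)%N) -> gcd_cond a N.+1 -> (3 <= N)%N ->
  (0 < m)%N -> (3 * m <= n)%N ->
  (2 * (N`! * (lcmA a N.+1 * N.+1) ^ N.+1) <= n * m ^ 2)%N ->
  (pA a (n + m)%N N.+1 * pA a (n - m)%N N.+1 < pA a n N.+1 ^ 2)%N.
Proof.
move=> a0 agcd N3 m0 mn; set D := lcmA a N.+1 => H.
have DE : D = \big[lcmn/1%N]_(i < N.+1) a i.+1 by rewrite /D /lcmA big_add1 /= big_mkord.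
have D0 : (0 < D)%N.
  rewrite DE; apply: (big_ind (fun x => 0 < x)%N) => // [x y x0 y0|i _].
    by rewrite lcmn_gt0 x0.
  exact: a0.
have aD (i : 'I_N.+1) : (a i.+1 %| D)%N by rewrite DE (biglcmn_sup i).
have [H1 H2] := parameter_bounds N3 D0 mn H.
set J := (N.+1 * D)%N in H1 H2.
have J0 : (0 < J)%N by rewrite muln_gt0.
(* Makes [pA_rising] applicable even at n - m. *)
have nJ : (J + m <= n)%N by nia.
pose b j : nat := ((quot_gf nat a N.+1 D)`_j)%R.
have bsum : (0 < \sum_(j < J.+1) b j)%N.
  by rewrite big_ord_recl /b /= quot_gf_coef0.
have mom := @moment_residue a N D a0 D0 aD agcd.
have lc : class_sum D J b (n + m)%N (fun x => rising N D (n%:R + m%:R - x)) *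
    class_sum D J b (n - m)%N (fun x => rising N D (n%:R - m%:R - x)) <
    class_sum D J b n (fun x => rising N D (n%:R - x)) ^+ 2 :> rat.
  apply: (class_sum_rising_log_concave D0 mom bsum N3 J0).
  - by rewrite leq_mul2r leqnSn orbT.
  - by rewrite ltr0n.
  - by rewrite -natrM ler_nat.
  - suff : (5 * N * J)%:R <= (2 * n)%:R :> rat by rewrite !natrM; lra.
    by rewrite ler_nat.
  - by rewrite -!natrX -!natrM ler_nat.
have E x : (J <= x)%N -> class_sum D J b x (fun y => rising N D (x%:R - y)) =
    (N`! * D ^ N * pA a x N.+1)%N%:R :> rat.
  by move=> Jx; rewrite (pA_rising a0 D0 aD rat Jx).
move: lc; rewrite -natrD -natrB; last by lia.
rewrite !E; [|lia|lia|lia].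
rewrite -natrM -natrX ltr_nat => lc.
have c0 : (0 < (N`! * D ^ N) ^ 2)%N by rewrite expn_gt0 muln_gt0 fact_gt0 expn_gt0 D0.
by rewrite -(ltn_pmul2l c0) -[X in (_ < X)%N]expnMn -[X in (X * _ < _)%N]mulnn mulnACA.
Qed.

(** Dropping the 1 in every factor 1 + iDk leaves k! (Dk)^k, and k!/k = N! for k = N+1. *)
Lemma dhat_ge (a : nat -> nat) (N : nat) :
  (N`! * (lcmA a N.+1 * N.+1) ^ N.+1)%N%:R <= dhat a N.+1.
Proof.
rewrite /dhat ler_pdivlMr ?ltr0n // -natrM ler_nat mulnAC [(N`! * _)%N]mulnC -factS.
rewrite big_add1 /= big_mkord.
have -> : (N.+1`! * (lcmA a N.+1 * N.+1) ^ N.+1 =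
    \prod_(i < N.+1) (i.+1 * (lcmA a N.+1 * N.+1)))%N.
  by rewrite big_split /= prod_nat_const card_ord fact_prod big_add1 /= big_mkord.
by apply: leq_prod => i _; rewrite mulnA leq_addl.
Qed.

(** Passing from M to M+1 multiplies C(n+M, M) by (n+M+1)/(M+1), and (n+M+1)^2 - m^2 < (n+M+1)^2.
    The step makes a weak inequality strict, so it can start from the equality at M = 0. *)
Lemma bin_log_concave (N n m : nat) : (0 < m)%N -> (m <= n)%N ->
  ('C(n + m + N.+1, N.+1) * 'C(n - m + N.+1, N.+1) < 'C(n + N.+1, N.+1) ^ 2)%N.
Proof.
move=> m0 mn.
have step M : ('C(n + m + M, M) * 'C(n - m + M, M) <= 'C(n + M, M) ^ 2)%N ->
    ('C(n + m + M.+1, M.+1) * 'C(n - m + M.+1, M.+1) < 'C(n + M.+1, M.+1) ^ 2)%N.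
  move=> le_M; rewrite -(@ltn_pmul2l (M.+1 ^ 2)) // -[X in (_ < X)%N]expnMn -{1}mulnn mulnACA.
  rewrite !addnS -!mul_bin_diag /= mulnACA expnMn.
  apply: leq_ltn_trans (leq_mul (leqnn _) le_M) _.
  by rewrite ltn_pmul2r ?expn_gt0 ?bin_gt0 ?leq_addl // !expnS expn0; nia.
elim: N => [|N /ltnW]; last exact: step.
by apply: step; rewrite !bin0.
Qed.

Lemma pA_const1 (n N : nat) : pA (fun=> 1%N) n N.+1 = 'C(n + N, N).
Proof. by rewrite pA_coef prodr_const card_ord coef_geom_exp ?natn. Qed.

Theorem theorem3p1 :
  (forall (a : nat -> nat),
     (forall i : nat, (0 < i)%N -> (0 < a i)%N) ->
     (forall i : nat, (0 < i)%N -> (a i <= a i.+1)%N) ->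
     forall m : nat, (2 <= m)%N ->
     forall k : nat, (4 <= k)%N ->
     gcd_cond a k ->
     (((3 * m ^ 3)%N%:R : rat) <= 2 * dhat a k  ->
        forall n : int, dhat a k <= n%:~R ->
          (pA a (n + m%:Z) k * pA a (n - m%:Z) k < pA a n k ^ 2)%N) /\
     (~ (((3 * m ^ 3)%N%:R : rat) <= 2 * dhat a k ) ->
        forall n : int, (3 * m)%:Z <= n ->
          (pA a (n + m%:Z) k * pA a (n - m%:Z) k < pA a n k ^ 2)%N)) /\
  (forall m : nat, (2 <= m)%N ->
   forall k : nat, (2 <= k)%N ->
   forall n : int, 0 < n ->
     (pA (fun _ => 1%N) (n + m%:Z) k * pA (fun _ => 1%N) (n - m%:Z) k
        < pA (fun _ => 1%N) n k ^ 2)%N).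
Proof.
split.
  move=> a a0 _ m m2 [//|N] N3 agcd; have := dhat_ge a N.
  set L := (N`! * _)%N => dL.
  suff main (n : nat) : (3 * m <= n)%N -> 2 * dhat a N.+1 <= (n * m ^ 2)%N%:R ->
      (pA a (n%:Z + m%:Z) N.+1 * pA a (n%:Z - m%:Z) N.+1 < pA a n N.+1 ^ 2)%N.
    split=> hm [n|n] hn.
    - have nd : dhat a N.+1 <= n%:R by [].
      (* Here 3m^3 <= 2 dhat <= 2n; as m >= 2, this gives 3m <= n, and 2 dhat <= 2n <= n m^2. *)
      have n3 : (3 * m ^ 3 <= 2 * n)%N.
        by rewrite -(ler_nat rat) natrM; lra.
      apply: main; first by move: n3; rewrite !expnS expn0; nia.
      apply: (@le_trans _ _ (2 * n)%N%:R); first by rewrite natrM; lra.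
      by rewrite ler_nat mulnC leq_mul2l !expnS expn0; apply/orP; right; nia.
    - have : (Negz n)%:~R < 0 :> rat by rewrite ltrz0.
      by have := le_trans (ler0n _ L) (le_trans dL hn); lra.
    - have n3 : (3 * m <= n)%N by [].
      (* Here 2 dhat < 3m^3 = (3m) m^2 <= n m^2. *)
      apply: main => //; move/negP: hm; rewrite -ltNge => /ltW hm.
      apply: le_trans hm _; rewrite ler_nat expnS mulnA.
      by rewrite leq_mul2r n3 orbT.
    - by [].
  move=> n3 hd; rewrite -PoszD subzn; last by lia.
  apply: pA_log_concave_of_large => //; first by lia.
  by rewrite -(ler_nat rat) natrM -/L; lra.
move=> m m2 [|[|N]] // _ [n|//] n0.
have [mn|nm] := leqP m n.
  by rewrite -PoszD subzn // !pA_const1 bin_log_concave //; lia.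
(* For m > n the argument n - m is negative, so the left side vanishes. *)
have [l ->] : exists l, n%:Z - m%:Z = Negz l.
  by exists (m - n).-1; rewrite NegzE; lia.
by rewrite muln0 pA_const1 expn_gt0 bin_gt0 leq_addl.
Qed.
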